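(* Let $K$ be a field and let $G$ be a finite simple graph with no isolated vertices. Then $g_{I(G)}(\nu(G))=0$.
   Context: Let $G$ have vertex set $\{1,\ldots,n\}$ and let $S=K[x_1,\ldots,x_n]$. The edge ideal $I(G)\subset S$ is generated by all $x_ix_j$ with $\{i,j\}$ an edge of $G$. A $k$-matching is a set of $k$ pairwise disjoint edges, and $\nu(G)$ is the maximum size of a matching of $G$. The $k$-th squarefree power $I(G)^{[k]}$ is the ideal generated by the squarefree monomials $x_{i_1}x_{j_1}\cdots x_{i_k}x_{j_k}$ where $\{i_1,j_1\},\ldots,\{i_k,j_k\}$ is a $k$-matching of $G$. For $1\le k\le \nu(G)$, $g_{I(G)}(k)=\operatorname{depth}(S/I(G)^{[k]})-(2k-1)$. *)

(* Defs.v *)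
From Stdlib Require Import ClassicalEpsilon.
From mathcomp Require Import all_boot all_order all_algebra.
From mathcomp Require Import mpoly.

Set Implicit Arguments.
Unset Strict Implicit.
Unset Printing Implicit Defensive.

Import GRing.Theory.
Local Open Scope ring_scope.

Section Ideals.
Variable R : comNzRingType.
Implicit Types (I B : R -> Prop) (f : R) (s : seq R).

Definition ideal_gen B : R -> Prop := fun f =>
  exists2 t : seq (R * R), (forall p, p \in t -> B p.2)
                         & f = \sum_(p <- t) p.1 * p.2.

Definition ideal_adjoin I f : R -> Prop := fun h =>
  exists2 a, I a & exists b, h = a + b * f.

(* [s] is a regular sequence on the module R/I, with I an ideal of R: each
   element is a nonzerodivisor on the quotient by its predecessors, and
   R/(I + (s)) is nonzero. *)
Fixpoint regular_seq I s : Prop :=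
  if s is f :: s' then
    (forall g, I (f * g) -> I g) /\ regular_seq (ideal_adjoin I f) s'
  else ~ I 1.

Definition is_depth (m I : R -> Prop) (d : nat) : Prop :=
  (exists s, [/\ size s = d, forall f, f \in s -> m f & regular_seq I s]) /\
  (forall s, (forall f, f \in s -> m f) -> regular_seq I s -> (size s <= d)%N).

(* The depth of R/I with respect to m, that is, the maximal length of an
   R/I-regular sequence in m; unspecified when there is no such maximum
   (e.g. when R/I = 0). *)
Definition depth (m I : R -> Prop) : nat := epsilon (inhabits 0%N) (is_depth m I).

End Ideals.

Definition graded_maximal_ideal (K : fieldType) (n : nat) :
    {mpoly K[n]} -> Prop :=
  ideal_gen (fun f => exists i : 'I_n, f = 'X_i).

Section Graphs.
(* The simple graph on 'I_n with (symmetric, irreflexive) adjacency [e]. *)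
Variables (n : nat) (e : rel 'I_n).

Definition edges : {set {set 'I_n}} :=
  [set [set p.1; p.2] | p : 'I_n * 'I_n & e p.1 p.2].

Definition is_matching (M : {set {set 'I_n}}) : bool :=
  (M \subset edges) && trivIset M.

Definition matching_number : nat :=
  \max_(M : {set {set 'I_n}} | is_matching M) #|M|.

Variable K : fieldType.

Definition matching_monomial (M : {set {set 'I_n}}) : {mpoly K[n]} :=
  \prod_(E in M) \prod_(i in E) 'X_i.

(* I(G)^[k]; for k = 1 this is the edge ideal I(G). *)
Definition squarefree_power (k : nat) : {mpoly K[n]} -> Prop :=
  ideal_gen (fun f => exists M : {set {set 'I_n}},
    [/\ is_matching M, #|M| = k & f = matching_monomial M]).

(* Meaningful for 1 <= k <= matching_number only. *)
Definition normalized_depth (k : nat) : int :=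
  (depth (@graded_maximal_ideal K n) (squarefree_power k))%:Z - (2 * k%:Z - 1).

End Graphs.

(* Main.v *)
From Stdlib Require Import ClassicalEpsilon.
Require Import Defs.
From mathcomp Require Import all_boot all_order all_algebra.
From mathcomp Require Import mpoly.
From mathcomp Require Import ring zify.

Set Implicit Arguments.
Unset Strict Implicit.
Unset Printing Implicit Defensive.

Import GRing.Theory.
Local Open Scope ring_scope.

(** Let d = 2 nu(G) and I = I(G)^[nu(G)].  The vertex sets of the maximum
    matchings of G are the bases of a matroid of rank d, the matching matroid,
    and I is generated by the squarefree monomials of these bases.  The matroid
    has no loops since G has no isolated vertices.  The claim is that S/I has
    depth d - 1.

    Lower bound.  For every ideal I generated by squarefree monomials of degree
    at least d, where d <= n + 1, the elementary symmetric polynomials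
    e_{d-1}, ..., e_1 form a regular sequence on S/I in this order
    ([elemsym_regular]); unlike with linear forms, the size of K does not
    matter.  The simplicial complex of I contains the full (d-2)-skeleton of the
    simplex, and S/I is obtained from the face ring of that skeleton by
    successive extensions by polynomial rings K[x_i : i in F] with |F| >= d.
    For skeletons the proof is by induction on the variables
    ([elemsym_regular_skeleton]), where the decreasing order of the degrees
    makes everything elementary ([regular_seq_add_variable]).

    Upper bound.  Multiplication by an element of (x_1, ..., x_n) is homotopic
    to zero on the Koszul complex of x_1, ..., x_n, so the Koszul cohomology of
    S/I vanishes in degrees smaller than the length of any regular sequence
    ([koszul_vanishing]).  The matroid yields a nonzero class in degree d - 1:
    a maximal chain of flats cuts the vertices into d blocks all of whose
    transversals are bases ([transversal_partition]).  With Y_i the part of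
    (x_1, ..., x_n) supported by the i-th block, the wedge product of
    Y_2, ..., Y_d is a cocycle modulo I, because its product with Y_1 has
    coefficients in I; it is not a coboundary, because I has no nonzero element
    of degree less than d ([regular_seq_obstruction]). *)

(** * Regular sequences *)

Section RegularSequences.
Variable R : comNzRingType.
Implicit Types (I J : R -> Prop) (a f g : R) (s : seq R).

Definition is_ideal I : Prop :=
  [/\ I 0, forall a b, I a -> I b -> I (a + b) & forall c a, I a -> I (c * a)].

Section IdealTheory.
Variables (I : R -> Prop) (idI : is_ideal I).

Lemma ideal0 : I 0.
Proof. by case: idI. Qed.

Lemma ideal_add a b : I a -> I b -> I (a + b).
Proof. by case: idI => _ + _; apply. Qed.

Lemma ideal_mull c a : I a -> I (c * a).
Proof. by case: idI => _ _; apply. Qed.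

Lemma ideal_mulr c a : I a -> I (a * c).
Proof. by rewrite mulrC; apply: ideal_mull. Qed.

Lemma ideal_opp a : I a -> I (- a).
Proof. by rewrite -mulN1r; apply: ideal_mull. Qed.

Lemma ideal_sub a b : I a -> I b -> I (a - b).
Proof. by move=> Ia Ib; apply/ideal_add/ideal_opp. Qed.

Lemma ideal_sum (T : eqType) (r : seq T) (P : pred T) (F : T -> R) :
  (forall i, i \in r -> P i -> I (F i)) -> I (\sum_(i <- r | P i) F i).
Proof.
move=> IF; rewrite big_seq_cond; apply: (big_ind I) => [||i /andP[]].
- exact: ideal0.
- exact: ideal_add.
exact: IF.
Qed.

Lemma ideal_congr a b : I (a - b) -> I a <-> I b.
Proof.
move=> Iab; split=> [Ia|Ib]; last by rewrite -(subrK b a); apply: ideal_add.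
by rewrite -(subKr a b); apply: ideal_sub.
Qed.

Lemma ideal_adjoinP f : is_ideal (ideal_adjoin I f).
Proof.
split=> [|a b [i Ii [u ->]] [j Ij [v ->]]|c a [i Ii [u ->]]].
- by exists 0; [apply: ideal0 | exists 0; rewrite mul0r addr0].
- by exists (i + j); [apply: ideal_add | exists (u + v); ring].
by exists (c * i); [apply: ideal_mull | exists (c * u); ring].
Qed.

Lemma sub_adjoin f a : I a -> ideal_adjoin I f a.
Proof. by exists a => //; exists 0; rewrite mul0r addr0. Qed.

Lemma mem_adjoin f : ideal_adjoin I f f.
Proof. by exists 0; [apply: ideal0 | exists 1; rewrite add0r mul1r]. Qed.

Lemma colon_ideal a : is_ideal (fun g => I (a * g)).
Proof.
split=> [|b c Ib Ic|c b Ib]; first by rewrite mulr0; apply: ideal0.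
  by rewrite mulrDr; apply: ideal_add.
by rewrite mulrCA; apply: ideal_mull.
Qed.

End IdealTheory.

Lemma adjoin_congr I J f g : is_ideal I -> (forall a, I a <-> J a) ->
  I (f - g) -> forall a, ideal_adjoin I f a <-> ideal_adjoin J g a.
Proof.
move=> idI IJ Ifg x; split=> [] [a Ia [b ->]].
  exists (a + b * (f - g)); last by exists b; ring.
  by apply: (IJ _).1; apply: ideal_add => //; apply: ideal_mull.
exists (a - b * (f - g)); last by exists b; ring.
by move/(IJ _).2 in Ia; apply: ideal_sub => //; apply: ideal_mull.
Qed.

Lemma adjoinC I f g a :
  ideal_adjoin (ideal_adjoin I f) g a -> ideal_adjoin (ideal_adjoin I g) f a.
Proof.
move=> [_ [i Ii [b ->]] [c ->]]; exists (i + c * g).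
  by exists i => //; exists c.
by exists b; ring.
Qed.

Lemma regular_seq_congr (T : eqType) I J (u v : T -> R) (l : seq T) :
    is_ideal I -> (forall a, I a <-> J a) ->
    (forall k, k \in l -> I (u k - v k)) ->
  regular_seq I (map u l) -> regular_seq J (map v l).
Proof.
elim: l I J => [|k l IHl] I J idI IJ Iuv /=; first by rewrite IJ.
case=> reg_k reg_l; have Ik := Iuv k (mem_head _ _); split=> [g /(IJ _).2 Ig|].
  apply: (IJ _).1; apply: reg_k; apply: (ideal_congr idI _).2 Ig.
  by rewrite -mulrBl; apply: ideal_mulr.
apply: IHl reg_l => [||i li]; first exact: ideal_adjoinP.
  exact: adjoin_congr.
by apply: sub_adjoin; apply: Iuv; rewrite inE li orbT.
Qed.

Lemma regular_seq_eqideal I J s : is_ideal I -> (forall a, I a <-> J a) ->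
  regular_seq I s -> regular_seq J s.
Proof.
move=> idI IJ; rewrite -[s]map_id; apply: regular_seq_congr => // k _.
by rewrite subrr; apply: ideal0.
Qed.

(** In terms of modules: if [s] is regular on the outer terms of
    0 -> R/(I : a) -> R/I -> R/(I + a) -> 0, it is regular on the middle one. *)
Lemma regular_seq_extension I a s : is_ideal I ->
    regular_seq (fun g => I (a * g)) s -> regular_seq (ideal_adjoin I a) s ->
  regular_seq I s.
Proof.
elim: s I => [|f s IHs] I idI /= => [_ nI1 I1|].
  by apply/nI1/sub_adjoin.
have idIa := ideal_adjoinP idI a; have idIf := ideal_adjoinP idI f.
have idC := colon_ideal idI a.
move=> [regC reg_sC] [regQ reg_sQ]; split=> [g Ifg|].
  have [i Ii [b def_g]] := regQ g (sub_adjoin a Ifg).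
  rewrite def_g; apply: ideal_add => //; rewrite mulrC; apply: regC.
  have -> : a * (f * b) = f * g - f * i by rewrite def_g; ring.
  by apply: ideal_sub => //; apply: ideal_mull.
apply: IHs => //.
  apply: regular_seq_eqideal reg_sC => [|g]; first exact: ideal_adjoinP.
  split=> [[h Ih [b ->]]|[i Ii [b def_ag]]].
    by exists (a * h) => //; exists (a * b); ring.
  have [|j Ij [c def_b]] := regQ b.
    exists (- i); first exact: ideal_opp.
    by exists g; rewrite [g * a]mulrC def_ag; ring.
  exists (g - c * f); last by exists c; ring.
  have -> : a * (g - c * f) = i + f * j by rewrite mulrBr def_ag def_b; ring.
  by apply: ideal_add => //; apply: ideal_mull.
apply: regular_seq_eqideal reg_sQ => [|g]; first exact: ideal_adjoinP.
by split; apply: adjoinC.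
Qed.

(** R/I is Hausdorff in the f-adic topology.  Over a Noetherian local ring this
    is Krull's intersection theorem; here it will come from a grading. *)
Definition separated I f : Prop :=
  forall g, (forall k, exists b, I (g - b * f ^+ k)) -> I g.

(** The point is that g is regular on R/I.  If g a = 0 in R/I, then a is
    divisible by f, and the quotient is again killed by g since f is regular;
    so a is divisible by all powers of f. *)
Lemma regular_seq_swap I f g s : is_ideal I -> separated I f ->
  regular_seq I [:: f, g & s] -> regular_seq I [:: g, f & s].
Proof.
move=> idI sepf /= [regf [regg reg_s]].
have reg_g a : I (g * a) -> I a.
  move=> Iga; apply: sepf; elim=> [|k [b Ib]].
    by exists a; rewrite expr0 mulr1 subrr; apply: ideal0.
  have Igb : I (g * b).
    have: I (f ^+ k * (g * b)).
      apply: (ideal_congr idI _).1 Iga.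
      have -> : g * a - f ^+ k * (g * b) = g * (a - b * f ^+ k) by ring.
      exact: ideal_mull.
    elim: k {Ib} => [|k IHk]; first by rewrite expr0 mul1r.
    by rewrite exprS -mulrA => /regf.
  have [c Ic [d def_b]] := regg b (sub_adjoin f Igb).
  exists d; have -> : a - d * f ^+ k.+1 = (a - b * f ^+ k) + f ^+ k * c.
    by rewrite def_b exprS; ring.
  by apply: ideal_add => //; apply: ideal_mull.
split=> //; split=> [a [i Ii [b def_fa]]|].
  have [|c Ic [d def_b]] := regg b.
    exists (- i); first exact: ideal_opp.
    by exists a; rewrite [a * f]mulrC def_fa; ring.
  exists (a - d * g); last by exists d; ring.
  apply: regf; have -> : f * (a - d * g) = i + g * c.
    by rewrite mulrBr def_fa def_b; ring.
  by apply: ideal_add => //; apply: ideal_mull.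
apply: regular_seq_eqideal reg_s => [|a].
  exact/ideal_adjoinP/ideal_adjoinP.
by split; apply: adjoinC.
Qed.

End RegularSequences.

(** * Koszul cohomology and upper bounds for depth *)

Section KoszulCochains.
Variables (R : comNzRingType) (T : finType).
Implicit Types (I : R -> Prop) (x y z : T -> R) (c b : seq T -> R) (t : seq T).

(** The differential of the Koszul complex, or the exterior product with the
    1-form y, expanded along the first letter: the value at j_0 ... j_k is the
    alternating sum of the y_{j_i} c(j_0 ... j_k without j_i).  Cochains are
    arbitrary functions on words instead of alternating ones, so that signs and
    orderings are dealt with by induction on words. *)
Fixpoint wedge y c t : R :=
  if t is j :: t' then y j * c t' - wedge y (fun u => c (j :: u)) t' else 0.

Lemma eq_wedge y y' c t : {in t, y =1 y'} -> wedge y c t = wedge y' c t.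
Proof.
elim: t c => [|j t IHt] c //= yy'; rewrite yy' ?mem_head // IHt // => i it.
by apply: yy'; rewrite inE it orbT.
Qed.

Lemma wedgeZB y a c c' t :
  wedge y (fun u => a * c u - c' u) t = a * wedge y c t - wedge y c' t.
Proof. by elim: t c c' => [|j t IHt] c c' /=; rewrite ?IHt; ring. Qed.

Lemma wedge_suml y (J : Type) (r : seq J) (a : J -> R) (c : J -> seq T -> R) t :
  wedge y (fun u => \sum_(j <- r) a j * c j u) t =
  \sum_(j <- r) a j * wedge y (c j) t.
Proof.
elim: t c => [|i t IHt] c /=; first by rewrite big1 // => j _; rewrite mulr0.
by rewrite IHt mulr_sumr -sumrB; apply: eq_bigr => j _; ring.
Qed.

Lemma wedge_sum (J : Type) (r : seq J) (y : J -> T -> R) c t :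
  wedge (fun i => \sum_(j <- r) y j i) c t = \sum_(j <- r) wedge (y j) c t.
Proof.
elim: t c => [|i t IHt] c /=; first by rewrite big1.
by rewrite IHt mulr_suml -sumrB.
Qed.

Lemma wedge_sq y c t : wedge y (wedge y c) t = 0.
Proof. by elim: t c => //= j t IHt c; rewrite wedgeZB IHt; ring. Qed.

Lemma wedge_anticomm y z c t : wedge y (wedge z c) t = - wedge z (wedge y c) t.
Proof.
by elim: t c => [|j t IHt] c /=; rewrite ?oppr0 // !wedgeZB IHt; ring.
Qed.

Lemma wedge_off y c t : {in t, forall j, y j = 0} -> wedge y c t = 0.
Proof.
elim: t c => [|j t IHt] c //= y0; rewrite y0 ?mem_head // IHt ?mul0r ?subr0 //.
by move=> i it; apply: y0; rewrite inE it orbT.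
Qed.

Lemma mem_ideal_wedge I y c t : is_ideal I ->
    (forall j u, j \in t -> (size u).+1 = size t -> I (y j * c u)) ->
  I (wedge y c t).
Proof.
move=> idI; elim: t c => [|j t IHt] c /= Ic; first exact: ideal0.
apply: ideal_sub => //; first by apply: Ic; rewrite ?mem_head.
by apply: IHt => i u it su; apply: Ic; rewrite ?inE ?it ?orbT //= su.
Qed.

(** Contraction with the functional x_j |-> a_j is a homotopy from
    multiplication by f = sum_j a_j x_j to zero on the Koszul complex. *)
Lemma wedge_contraction x (a : T -> R) c t :
  (\sum_j a j * x j) * c t =
  \sum_j a j * wedge x c (j :: t) +
  wedge x (fun u => \sum_j a j * c (j :: u)) t.
Proof.
rewrite (wedge_suml _ _ _ (fun j u => c (j :: u))) -big_split mulr_suml.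
by apply: eq_bigr => j _ /=; ring.
Qed.

(** Koszul cohomology of R/I vanishes in degrees below the length of a regular
    sequence [s] of elements of the ideal (x).  If f is the first element of
    [s] and b the contraction of c against f, then f c = x /\ b mod I, so b is
    a cocycle of R/(I + f), hence b = x /\ b' + f g by induction; thus
    f (c - x /\ g) lies in I, and f can be cancelled. *)
Lemma koszul_vanishing x s I : is_ideal I ->
    (forall f, f \in s -> exists a : T -> R, f = \sum_j a j * x j) ->
    regular_seq I s ->
  forall i c, (i < size s)%N -> (forall t, size t = i.+1 -> I (wedge x c t)) ->
  exists b, forall t, size t = i -> I (c t - wedge x b t).
Proof.
elim: s I => [|f s IHs] I idI //= xs [regf reg_s] i c lt_is Iwc.
have [a def_f] := xs f (mem_head _ _).
pose b0 u := \sum_j a j * c (j :: u).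
have fcE t : size t = i -> I (f * c t - wedge x b0 t).
  move=> st; rewrite def_f wedge_contraction addrK; apply: ideal_sum => //.
  by move=> j _ _; apply: ideal_mull => //; apply: Iwc => /=; rewrite st.
case: i => [|i] in lt_is Iwc fcE *.
  exists c => -[|//] _; apply: regf; have:= fcE [::] erefl.
  by rewrite /= !subr0.
have [|||b Ib] := IHs _ (ideal_adjoinP idI f) _ reg_s i b0 => //.
- by move=> g sg; apply: xs; rewrite inE sg orbT.
- move=> t st; exists (- (f * c t - wedge x b0 t)).
    by apply: ideal_opp => //; apply: fcE.
  by exists (c t); ring.
pose g t := epsilon (inhabits 0) (fun g => I (b0 t - wedge x b t - g * f)).
have Ig t : size t = i -> I (f * g t - (b0 t - wedge x b t)).
  move=> /Ib[j Ij [h def_j]]; rewrite -opprB [f * _]mulrC.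
  apply: ideal_opp => //.
  apply: (epsilon_spec _ (fun h => I (b0 t - wedge x b t - h * f))).
  by exists h; rewrite def_j addrK.
exists g => t st; apply: regf.
have -> : f * (c t - wedge x g t) = (f * c t - wedge x b0 t) -
    wedge x (fun u => f * g u - (1 * b0 u - wedge x b u)) t.
  by rewrite !wedgeZB wedge_sq; ring.
apply: ideal_sub => //; first exact: fcE.
apply: mem_ideal_wedge => // j u _; rewrite st => -[su].
by rewrite mul1r; apply: ideal_mull => //; apply: Ig.
Qed.

Lemma wedge_eq0 y c t : (forall u, c u = 0) -> wedge y c t = 0.
Proof.
by elim: t c => [|j t IHt] c //= c0; rewrite c0 IHt ?mulr0 ?subr0.
Qed.

Section DecomposableCochains.
Variables (J : finType) (Y : J -> T -> R).
Implicit Types (l : seq J).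

Definition wedges l : seq T -> R := foldr (fun i => wedge (Y i)) (fun=> 1) l.

Lemma wedge_wedges0 i l t : i \in l -> wedge (Y i) (wedges l) t = 0.
Proof.
elim: l t => // k l IHl t; rewrite inE.
have [<- _|_ /= il] := eqVneq; first exact: wedge_sq.
by rewrite wedge_anticomm wedge_eq0 ?oppr0 // => u; apply: IHl.
Qed.

Lemma mem_ideal_wedges I l a t : is_ideal I -> size t = size l ->
    (forall u, size u = size l -> I (a * \prod_(p <- zip l u) Y p.1 p.2)) ->
  I (a * wedges l t).
Proof.
move=> idI; elim: l a t => [|i l IHl] a t st Ia /=.
  by have:= Ia [::] erefl; rewrite big_nil.
apply: (mem_ideal_wedge (colon_ideal idI a)) => j u _; rewrite st => -[su].
rewrite mulrA; apply: IHl => // v sv.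
by have:= Ia (j :: v); rewrite big_cons mulrA; apply; rewrite /= sv.
Qed.

Lemma wedges_transversal (b : J -> T) l :
    uniq l -> (forall i k, i != k -> Y i (b k) = 0) ->
  wedges l (map b l) = \prod_(i <- l) Y i (b i).
Proof.
move=> + b_dual; elim: l => [|i l IHl] /=; first by rewrite big_nil.
case/andP=> il uniq_l; rewrite big_cons IHl // wedge_off ?subr0 // => j.
by case/mapP=> k kl ->; apply: b_dual; apply: contraNneq il => ->.
Qed.

(** A nonzero class in degree #|J| - 1 of the Koszul cohomology of R/I.  Write
    x as the sum of the Y_i and let c be the wedge of all Y_i but one, Y_0.
    Then x /\ c = Y_0 /\ c has coefficients in the ideal of the products of
    the Y_i, so c is a cocycle mod I.  If c were x /\ b mod I, then
    x /\ c would have coefficients in (x) I, as x /\ x = 0; but the product of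
    the Y_i (b_i) is one of them. *)
Lemma regular_seq_obstruction x (b : J -> T) I I' s :
    is_ideal I -> is_ideal I' -> (forall j g, I g -> I' (x j * g)) ->
    (forall j, x j = \sum_i Y i j) ->
    (forall u : J -> T, I (\prod_i Y i (u i))) ->
    (forall i k, i != k -> Y i (b k) = 0) ->
    (forall f, f \in s -> exists a : T -> R, f = \sum_j a j * x j) ->
    regular_seq I s -> (0 < #|J| <= size s)%N ->
  I' (\prod_i Y i (b i)).
Proof.
move=> idI idI' xI def_x IY b_dual xs reg_s /andP[].
have uniqJ := enum_uniq J; have allJ i : i \in enum J by rewrite mem_enum.
rewrite -big_enum cardE -wedges_transversal //.
case def_J: (enum J) uniqJ allJ => [|i0 l] // uniq_l allJ _ lt_ls.
have wx t : wedges (i0 :: l) t = wedge x (wedges l) t.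
  pose y' j := \sum_(i <- i0 :: l) Y i j.
  apply: esym; rewrite (eq_wedge (y' := y')) => [|j _].
    rewrite wedge_sum big_cons big_seq big1 ?addr0 // => i il.
    exact: wedge_wedges0.
  by rewrite def_x -big_enum def_J.
have Iwx t : size t = (size l).+1 -> I (wedge x (wedges l) t).
  move=> st; rewrite -wx -[X in I X]mul1r.
  apply: (mem_ideal_wedges (l := i0 :: l) idI) => // u su.
  have := IY (fun i => nth (b i0) u (index i (i0 :: l))).
  rewrite -big_enum def_J mul1r; congr I.
  have -> : zip (i0 :: l) u =
      [seq (i, nth (b i0) u (index i (i0 :: l))) | i <- i0 :: l].
    apply: (@eq_from_nth _ (i0, b i0)) => [|k].
      by rewrite size_zip su size_map minnn.
    rewrite size_zip su minnn => lt_k.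
    by rewrite nth_zip ?su // (nth_map i0) // index_uniq.
  by rewrite big_map.
have [c Ic] := koszul_vanishing idI xs reg_s lt_ls Iwx.
rewrite wx.
have -> : wedge x (wedges l) (map b (i0 :: l)) =
    wedge x (fun u => 1 * wedges l u - wedge x c u) (map b (i0 :: l)).
  by rewrite wedgeZB wedge_sq subr0 mul1r.
apply: mem_ideal_wedge => // j u _ /= [su]; apply: xI; rewrite mul1r.
by apply: Ic; rewrite su size_map.
Qed.

End DecomposableCochains.
End KoszulCochains.

(** * Graded ideals of the polynomial ring *)

Section GradedIdeals.
Variables (K : fieldType) (n : nat).
Implicit Types (I : {mpoly K[n]} -> Prop) (p q f g : {mpoly K[n]}).
Implicit Types (m : 'X_{1..n}) (s : seq {mpoly K[n]}).

Definition graded_ideal I : Prop :=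
  is_ideal I /\ forall p d, I p -> I (pihomog mdeg d p).

Lemma pihomogMr d e p f : f \is e.-homog ->
  pihomog mdeg d (p * f) = if (e <= d)%N then pihomog mdeg (d - e) p * f else 0.
Proof.
move=> fh; elim/mpolyind: p => [|c m p _ _ IHp].
  by rewrite mul0r !pihomog0 mul0r if_same.
rewrite mulrDl !pihomogD IHp -scalerAl !linearZ /= pihomogX.
have Xfh : 'X_[m] * f \is (mdeg m + e).-homog.
  by apply: dhomogM; rewrite ?dhomogX.
have [de|de] := eqVneq (mdeg m + e)%N d.
  rewrite -de (pihomog_dE Xfh) leq_addl addnK eqxx mulrDl.
  by rewrite -scalerAl.
rewrite (pihomog_ne0 de Xfh) scaler0 add0r.
case: leqP => // le_ed; rewrite ifN ?scaler0 ?add0r //.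
by apply: contraNneq de => ->; rewrite subnK.
Qed.

Lemma graded_adjoin I e f : graded_ideal I -> f \is e.-homog ->
  graded_ideal (ideal_adjoin I f).
Proof.
move=> [idI grI] fh; split; first exact: ideal_adjoinP.
move=> _ d [p Ip [b ->]]; rewrite pihomogD (pihomogMr _ _ fh).
exists (pihomog mdeg d p); first exact: grI.
by case: leqP => _; [exists (pihomog mdeg (d - e) b) | exists 0; rewrite mul0r].
Qed.

(** If g = b f^(d+1) modulo I, then the component of degree d of g lies in I, as
    that of b f^(d+1) is zero. *)
Lemma graded_separated I e f : graded_ideal I -> f \is e.-homog -> (0 < e)%N ->
  separated I f.
Proof.
move=> [idI grI] fh e_gt0 g If.
rewrite (pihomog_partitionE (leqnn (msize g))); apply: ideal_sum => // d _ _.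
have [b Ib] := If d.+1; have := grI _ d Ib; rewrite pihomogB.
have fkh : f ^+ d.+1 \is (e * d.+1).-homog by apply: dhomogMn.
by rewrite (pihomogMr _ _ fkh) ifF ?subr0 // leqNgt leq_pmull.
Qed.

(** A homogeneous regular sequence can be permuted, so its first element can be
    moved to the end and forgotten. *)
Lemma regular_seq_behead I e f s :
    graded_ideal I -> f \is e.-homog -> (0 < e)%N ->
    (forall g, g \in s -> exists d, g \is d.-homog) ->
  regular_seq I (f :: s) -> regular_seq I s.
Proof.
move=> + fh e_gt0; elim: s I => [|g s IHs] I grI sh.
  by move=> /= [_ nI1 I1]; apply/nI1/sub_adjoin.
have [idI _] := grI; have [d gh] := sh g (mem_head _ _).
move/(regular_seq_swap idI (graded_separated grI fh e_gt0)) => [regg regfs].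
split=> //; apply: IHs regfs => [|h sh']; first exact: graded_adjoin gh.
by apply: sh; rewrite inE sh' orbT.
Qed.

Fixpoint countdown k : seq nat :=
  if k is k'.+1 then k :: countdown k' else [::].

Lemma size_countdown k : size (countdown k) = k.
Proof. by elim: k => //= k ->. Qed.

Lemma mem_countdown k i : (i \in countdown k) = (0 < i <= k)%N.
Proof.
elim: k => [|k IHk] /=; first by case: i.
by rewrite inE IHk [(i <= k.+1)%N]leq_eqVlt ltnS; case: eqP => //= ->.
Qed.

(** If a_1, ..., a_r are the elementary symmetric polynomials of a set of
    variables not containing x, and a_{r+1} vanishes, then a_k + x a_{k-1} are
    those of the set enlarged by x.  The order r+1, ..., 1 makes the induction
    work: modulo I the first element is x a_r, and the two sides of
    0 -> R/(I + x) -> R/(I + x a_r) -> R/(I + a_r) -> 0 are a ring where the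
    remaining elements are a_r, ..., a_1, and one where the hypotheses hold
    again with r - 1 for r. *)
Lemma regular_seq_add_variable I x (a : nat -> {mpoly K[n]}) r :
    graded_ideal I -> x \is 1.-homog -> (forall k, a k \is k.-homog) ->
    a 0%N = 1 -> I (a r.+1) ->
    regular_seq I (x :: map a (countdown r)) ->
  regular_seq I [seq a k + x * a k.-1 | k <- countdown r.+1].
Proof.
move=> + xh ah a0; elim: r I => [|r IHr] I grI Ia reg_xa; have [idI _] := grI.
  apply: (regular_seq_congr (u := fun=> x) (l := [:: 1%N]) idI) reg_xa => // k.
  rewrite inE => /eqP-> /=; rewrite a0 mulr1 opprD addrCA subrr addr0.
  exact: ideal_opp.
have [regx [regax regs]] := reg_xa.
have swap_xa := regular_seq_swap idI (graded_separated grI xh isT).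
have [rega rega'] := swap_xa _ _ reg_xa.
set h : {mpoly K[n]} := a r.+2 + x * a r.+1.
have Ih : I (h - x * a r.+1) by rewrite addrK.
have regh g : I (h * g) -> I g.
  move=> Ihg; apply/rega/regx; rewrite mulrA.
  by apply: (ideal_congr idI _).1 Ihg; rewrite -mulrBl; apply: ideal_mulr.
change (regular_seq I (h :: [seq a k + x * a k.-1 | k <- countdown r.+1])).
split=> //.
have hh : h \is r.+2.-homog.
  by apply: dhomogD; [apply: ah | apply: (dhomogM xh)].
have [idJ grJ] := graded_adjoin grI hh.
move: {hh} h Ih regh idJ grJ => h Ih regh idJ grJ.
apply: (regular_seq_extension (a := a r.+1)) => //.
  have: regular_seq (ideal_adjoin I x) (map a (countdown r.+1)) by split.
  apply: regular_seq_congr => [||k _]; first exact: ideal_adjoinP.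
    move=> g; split=> [[p Ip [b ->]]|[p Ip [b def_ag]]].
      exists (a r.+1 * p - b * (h - x * a r.+1)).
        by apply: ideal_sub => //; apply: ideal_mull.
      by exists b; ring.
    exists (g - b * x); last by exists b; ring.
    apply: rega; have -> : a r.+1 * (g - b * x) = p + b * (h - x * a r.+1).
      by rewrite mulrBr def_ag; ring.
    by apply: ideal_add => //; apply: ideal_mull.
  exists 0; first exact: ideal0.
  by exists (- a k.-1); ring.
apply: (regular_seq_eqideal (I := ideal_adjoin I (a r.+1))) => [|g|].
- exact: ideal_adjoinP.
- split=> [[p Ip [b ->]]|[_ [p Ip [b ->]] [c ->]]].
    exists p; last by exists b.
    by apply: sub_adjoin.
  exists (p + b * (h - x * a r.+1)); last by exists (b * x + c); ring.
  by apply: ideal_add => //; apply: ideal_mull.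
apply: IHr => //; first exact: graded_adjoin (ah _).
exact: mem_adjoin.
Qed.

End GradedIdeals.

(** * Squarefree monomial ideals and elementary symmetric polynomials *)

Section MonomialIdeals.
Variables (K : fieldType) (n : nat).
Implicit Types (p q f g : {mpoly K[n]}) (m : 'X_{1..n}).
Implicit Types (P : pred 'X_{1..n}).

Definition monomial_ideal P p : Prop := forall m, m \in msupp p -> P m.

Definition madd_closed P : Prop := forall m m', P m -> P (m + m')%MM.

Lemma monomial_ideal_graded P :
  madd_closed P -> graded_ideal (monomial_ideal P).
Proof.
move=> addP; split; first split.
- by move=> m; rewrite msupp0.
- by move=> p q Pp Pq m /msuppD_le; rewrite mem_cat => /orP[/Pp|/Pq].
- move=> p q Pq m /msuppM_le /allpairsP[[m1 m2] /= [_ /Pq Pm2 ->]].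
  by rewrite addmC; apply: addP.
move=> p d Pp m; rewrite pihomogE => /msupp_sum_le /flatten_mapP[m'].
by rewrite mem_filter => /andP[_ /Pp Pm'] /msuppZ_le /mem_msuppXP <-.
Qed.

Lemma monomial_ideal_eq P P' p :
  P =1 P' -> monomial_ideal P p <-> monomial_ideal P' p.
Proof. by move=> eqP; split=> Pp m /Pp; rewrite eqP. Qed.

Lemma monomial_idealX P m : monomial_ideal P 'X_[m] <-> P m.
Proof.
by split=> [|Pm m' /mem_msuppXP <- //]; apply; rewrite msuppX mem_head.
Qed.

Lemma monomial_ideal_colon P a p :
  monomial_ideal P ('X_[a] * p) <-> monomial_ideal (fun m => P (a + m)%MM) p.
Proof.
rewrite mulrC; split=> Pp m.
  by move=> pm; apply: Pp; rewrite (perm_mem (msuppMX _ _)); apply: map_f.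
by rewrite (perm_mem (msuppMX _ _)) => /mapP[m' /Pp Pm' ->].
Qed.

Lemma monomial_ideal_adjoin P a p : madd_closed P ->
  ideal_adjoin (monomial_ideal P) 'X_[a] p <->
  monomial_ideal (fun m => P m || (a <= m)%MM) p.
Proof.
move=> addP; have [idP _] := monomial_ideal_graded addP.
have idPa := ideal_adjoinP idP 'X_[a].
split=> [[q Pq [b ->]] m /msuppD_le|Pp].
  rewrite mem_cat => /orP[/Pq -> //|].
  by rewrite (perm_mem (msuppMX _ _)) => /mapP[m' _ ->]; rewrite lem_addr orbT.
rewrite [p]mpolyE; apply: ideal_sum => // m /Pp Pam _.
rewrite -mul_mpolyC; apply: ideal_mull => //.
case/orP: Pam => [Pm|am]; first by apply/sub_adjoin/monomial_idealX.
rewrite -(submK am) mpolyXD; apply: ideal_mull => //; exact: mem_adjoin.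
Qed.

End MonomialIdeals.

Section SquarefreeMonomialIdeals.
Variables (K : fieldType) (n : nat).
Implicit Types (p : {mpoly K[n]}) (N : pred {set 'I_n}) (F G T h : {set 'I_n}).

Definition mvars (m : 'X_{1..n}) : {set 'I_n} := [set i | m i != 0%N].

Lemma mvarsD m m' : mvars (m + m') = mvars m :|: mvars m'.
Proof. by apply/setP=> i; rewrite !inE mnmDE addn_eq0 negb_and. Qed.

Lemma mvars_mesym1 F : mvars (mesym1 F) = F.
Proof. by apply/setP=> i; rewrite inE mnmE; case: (i \in F). Qed.

Lemma mesym1_le F m : (mesym1 F <= m)%MM = (F \subset mvars m).
Proof.
apply/mnm_lepP/subsetP => [le_Fm i iF|sFm i]; rewrite ?inE ?mnmE.
  by have:= le_Fm i; rewrite mnmE iF lt0n.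
by case: (boolP (i \in F)) => // /sFm; rewrite inE lt0n.
Qed.

Lemma card_mvars m : (#|mvars m| <= mdeg m)%N.
Proof.
rewrite mdegE -sum1_card big_mkcond leq_sum // => i _.
by rewrite inE; case: (m i).
Qed.

Definition upward N : Prop := forall T T', T \subset T' -> N T -> N T'.

(** The Stanley-Reisner ideal whose non-faces are the members of [N]. *)
Definition face_ideal N : {mpoly K[n]} -> Prop :=
  monomial_ideal (fun m => N (mvars m)).

Lemma face_ideal_graded N : upward N -> graded_ideal (face_ideal N).
Proof.
move=> upN; apply: monomial_ideal_graded => m m'.
by rewrite mvarsD; apply: upN; apply: subsetUl.
Qed.

Lemma face_ideal_ideal N : upward N -> is_ideal (face_ideal N).
Proof. by case/face_ideal_graded. Qed.

Lemma face_ideal_eq N N' p : N =1 N' -> face_ideal N p <-> face_ideal N' p.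
Proof. by move=> eqN; apply: monomial_ideal_eq => m; apply: eqN. Qed.

Lemma face_idealX N F : face_ideal N 'X_[mesym1 F] <-> N F.
Proof. by rewrite /face_ideal monomial_idealX mvars_mesym1. Qed.

Lemma face_ideal_colon N F p :
  face_ideal N ('X_[mesym1 F] * p) <-> face_ideal (fun T => N (F :|: T)) p.
Proof.
rewrite /face_ideal monomial_ideal_colon; apply: monomial_ideal_eq => m.
by rewrite mvarsD mvars_mesym1.
Qed.

Lemma face_ideal_adjoin N F p : upward N ->
  ideal_adjoin (face_ideal N) 'X_[mesym1 F] p <->
  face_ideal (fun T => N T || (F \subset T)) p.
Proof.
move=> upN; rewrite /face_ideal monomial_ideal_adjoin => [|m m'].
  by apply: monomial_ideal_eq => m; rewrite mesym1_le.
by rewrite mvarsD; apply: upN; apply: subsetUl.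
Qed.

Lemma upward_colon N F : upward N -> upward (fun T => N (F :|: T)).
Proof. by move=> upN T T' sTT'; apply: upN; apply: setUS. Qed.

Lemma upward_adjoin N F : upward N -> upward (fun T => N T || (F \subset T)).
Proof.
move=> upN T T' sTT' /orP[/(upN _ _ sTT') -> //|sFT].
by rewrite (subset_trans sFT) ?orbT.
Qed.

Definition elemsym F k : {mpoly K[n]} :=
  \sum_(h : {set 'I_n} | (h \subset F) && (#|h| == k)) 'X_[mesym1 h].

Lemma elemsym_homog F k : elemsym F k \is k.-homog.
Proof.
by apply: rpred_sum => h /andP[_ /eqP <-]; rewrite dhomogX /= mdeg_mesym1.
Qed.

Lemma elemsym0 F : elemsym F 0 = 1.
Proof.
rewrite /elemsym (big_pred1 set0) ?mesym1_set0 ?mpolyX0 // => h.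
by rewrite cards_eq0 /=; case: eqP => [->|_]; rewrite ?sub0set ?andbF.
Qed.

Lemma elemsymS v F k : v \notin F ->
  elemsym (v |: F) k.+1 = elemsym F k.+1 + 'X_v * elemsym F k.
Proof.
move=> vF; rewrite /elemsym (bigID (fun h => v \in h)) [RHS]addrC /=.
congr (_ + _); last first.
  apply: eq_bigl => h; rewrite andbAC; congr (_ && _).
  apply/andP/idP => [[svF vh]|hF].
    by rewrite -(setU1K vF) subsetD1 svF.
  by rewrite (subset_trans hF (subsetUr _ _)) (contra ((subsetP hF) v)).
rewrite mulr_sumr (reindex_onto (setU [set v]) (fun h => h :\ v)) /=.
  2: by move=> h /andP[_ vh]; rewrite setD1K.
have setU1K_eq h : ((v |: h) :\ v == h) = (v \notin h).
  case: (boolP (v \in h)) => [vh|/setU1K->]; last exact: eqxx.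
  by apply: contraTF vh => /eqP <-; rewrite setD11.
apply: eq_big => [h|h].
  rewrite setU11 andbT setU1K_eq; case: (boolP (v \in h)) => vh.
    by rewrite andbF; apply/esym/negbTE; apply: contra vF => /andP[/subsetP->].
  rewrite andbT cardsU1 vh eqSS; congr (_ && _).
  by rewrite -{2}(setU1K vF) subsetD1 vh andbT subUset sub1set setU11.
rewrite setU1K_eq => /andP[_ vh]; rewrite -mpolyXD; congr 'X_[_].
apply/mnmP=> i; rewrite mnmDE !mnmE !inE eq_sym.
by case: eqP => // <-; rewrite (negbTE vh).
Qed.

Lemma elemsym_congr N F G k : upward N -> G \subset F ->
    (forall h, h \subset F -> ~~ (h \subset G) -> #|h| = k -> N h) ->
  face_ideal N (elemsym F k - elemsym G k).
Proof.
move=> upN sGF Nh; rewrite /elemsym (bigID (fun h => h \subset G)) /= addrAC.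
rewrite (eq_bigl (fun h => (h \subset G) && (#|h| == k))) => [|h].
  rewrite subrr add0r; apply: ideal_sum => [|h _ /andP[/andP[hF /eqP hk] hG]].
    exact: face_ideal_ideal.
  by apply/face_idealX; apply: Nh.
case: (boolP (h \subset G)) => hG; last by rewrite andbF.
by rewrite (subset_trans hG sGF) andbT.
Qed.

(** The non-faces of the complex of all subsets of F with at most d elements. *)
Definition skeleton F d : pred {set 'I_n} :=
  fun T => ~~ (T \subset F) || (d < #|T|)%N.

Lemma upward_skeleton F d : upward (skeleton F d).
Proof.
move=> T T' sTT'; rewrite /skeleton => /orP[TF|dT]; apply/orP; [left|right].
  by apply: contra TF; apply: subset_trans.
exact: leq_trans dT (subset_leq_card sTT').
Qed.

(** Induction on F.  For v in F put G = F minus v.  The colon ideal by x_v does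
    not involve x_v, and adding x_v to it gives the ideal for G and d - 1;
    adding x_v to the original ideal gives the ideal for G and d.  The extension
    lemma glues the two, except when F has just d elements, where e_d vanishes
    on G: but then the ideal and its colon ideal coincide. *)
Lemma elemsym_regular_skeleton F d : (d <= #|F|)%N ->
  regular_seq (face_ideal (skeleton F d)) (map (elemsym F) (countdown d)).
Proof.
move cF: #|F| => c; elim: c F cF d => [|c IHc] F cF [|d] // le_dF; try
  by rewrite /= -mpolyX0 -mesym1_set0 face_idealX /skeleton sub0set cards0.
have /card_gt0P[v vF] : (0 < #|F|)%N by rewrite cF.
pose G := F :\ v; have def_F : v |: G = F := setD1K vF.
have vG : v \notin G by rewrite setD11.
have cG : #|G| = c by apply/eqP; rewrite -eqSS -cF (cardsD1 v F) vF.
have sGF : G \subset F := subsetDl _ _.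
have sTG T : (T \subset G) = (T \subset F) && (v \notin T) by rewrite subsetD1.
have upS := @upward_skeleton.
pose link T := skeleton F d.+1 (v |: T).
have upL : upward link := upward_colon (F := [set v]) (upS F d.+1).
have linkE T : link T || ([set v] \subset T) = skeleton G d T.
  rewrite /link /skeleton sub1set sTG cardsU1 subUset sub1set vF /=.
  by case: (v \in T); rewrite /= ?orbT ?andbF ?andbT ?orbF.
have reg_link :
    regular_seq (face_ideal link) (map (elemsym F) (countdown d.+1)).
  have -> : map (elemsym F) (countdown d.+1) =
            [seq elemsym G k + 'X_v * elemsym G k.-1 | k <- countdown d.+1].
    apply/eq_in_map => k; rewrite mem_countdown => /andP[k_gt0 _].
    by rewrite -def_F -(prednK k_gt0) elemsymS.
  apply: regular_seq_add_variable.
  - exact: face_ideal_graded.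
  - by rewrite dhomogX /= mdeg1.
  - exact: elemsym_homog.
  - exact: elemsym0.
  - apply: ideal_sum => [|h _ /andP[hG /eqP ch]]; first exact: face_ideal_ideal.
    apply/face_idealX; rewrite /link /skeleton cardsU1 ch.
    by move: hG; rewrite sTG => /andP[_ ->]; rewrite add1n ltnSn orbT.
  split=> [g|].
    rewrite -mesym1_set1 => /face_ideal_colon.
    apply: (face_ideal_eq _ _).1 => T.
    by rewrite /link setUA setUid.
  have := IHc G cG d le_dF; apply: regular_seq_eqideal.
    exact/face_ideal_ideal/upS.
  move=> p; rewrite -mesym1_set1 face_ideal_adjoin //.
  by apply: face_ideal_eq => T; rewrite linkE.
have [le_dc|lt_cd] := leqP d.+1 c; last first.
  apply: regular_seq_eqideal reg_link => [|p]; first exact: face_ideal_ideal.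
  apply: face_ideal_eq => T; rewrite /link /skeleton subUset sub1set vF /=.
  case: (boolP (T \subset F)) => //= sTF; rewrite [RHS]ltnNge.
  have -> : (#|T| <= d.+1)%N.
    by rewrite (leq_trans (subset_leq_card sTF)) ?cF.
  apply/negbTE; rewrite -leqNgt.
  have: v |: T \subset F by rewrite subUset sub1set vF.
  by move/subset_leq_card => /leq_trans; apply; rewrite cF.
have idS := face_ideal_ideal (upS F d.+1).
apply: (regular_seq_extension (a := 'X_[mesym1 [set v]])) => //.
  apply: regular_seq_eqideal reg_link => [|p]; first exact: face_ideal_ideal.
  by rewrite face_ideal_colon.
apply: (regular_seq_congr (I := face_ideal (skeleton G d.+1)) (u := elemsym G)).
- exact/face_ideal_ideal/upS.
- move=> p; rewrite face_ideal_adjoin //; apply: face_ideal_eq => T.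
  rewrite /skeleton sub1set sTG.
  by case: (v \in T); rewrite /= ?orbT ?andbF ?andbT ?orbF.
- move=> k _; rewrite -opprB.
  apply: (ideal_opp (face_ideal_ideal (upS G d.+1))).
  by apply: elemsym_congr => // h hF hG _; rewrite /skeleton hG.
exact: IHc.
Qed.

Lemma elemsym_regular_tail I F d l : graded_ideal I -> (d <= l)%N ->
  regular_seq I (map (elemsym F) (countdown l)) ->
  regular_seq I (map (elemsym F) (countdown d)).
Proof.
move=> grI; elim: l => [|l IHl]; first by rewrite leqn0 => /eqP->.
rewrite leq_eqVlt ltnS => /predU1P[-> //|le_dl] reg_l; apply: IHl => //.
apply: (regular_seq_behead grI (elemsym_homog F l.+1)) reg_l => // g.
by case/mapP=> k _ ->; exists k; apply: elemsym_homog.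
Qed.

(** A facet F of the complex has I : x^F = (x_i : i not in F), so that R/I is
    an extension of the face ring of the complex without the face F by the
    polynomial ring on F.  Peeling off in this way all faces with more than d
    elements leaves a skeleton of the simplex. *)
Lemma elemsym_regular N d : upward N -> (forall T, N T -> (d < #|T|)%N) ->
    (d <= n)%N ->
  regular_seq (face_ideal N) (map (elemsym setT) (countdown d)).
Proof.
move=> + + le_dn; have upS := @upward_skeleton.
have [c] := ubnP #|[set T | ~~ N T]|.
elim: c N => // c IHc N; rewrite ltnS => le_c upN Nd.
have idN := face_ideal_ideal upN.
pose face T := ~~ N T && (d < #|T|)%N.
have [F0 faceF0|noF] := pickP face; last first.
  have := @elemsym_regular_skeleton setT d; rewrite cardsT card_ord.
  move/(_ le_dn); apply: regular_seq_eqideal => [|p].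
    exact/face_ideal_ideal/upS.
  apply: face_ideal_eq => T; rewrite /skeleton subsetT /=.
  apply/idP/idP => [dT|/Nd //].
  by have:= noF T; rewrite /face dT andbT => /negbFE.
have [F /andP[NF dF] maxF] := arg_maxnP (fun T : {set 'I_n} => #|T|) faceF0.
have linkE T : N (F :|: T) = skeleton F #|F| T.
  rewrite /skeleton; case: (boolP (T \subset F)) => [sTF|nsTF] /=.
    by rewrite (setUidPl sTF) (negbTE NF) ltnNge subset_leq_card.
  apply: contraR nsTF => NFT; have /maxF : face (F :|: T).
    by rewrite /face NFT (leq_trans dF) // subset_leq_card ?subsetUl.
  move=> le_FTF; have /eqP -> : F == F :|: T by rewrite eqEcard subsetUl.
  exact: subsetUr.
apply: (regular_seq_extension (a := 'X_[mesym1 F])) => //.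
  apply: (regular_seq_eqideal (I := face_ideal (skeleton F #|F|))) => [|p|].
  - exact/face_ideal_ideal/upS.
  - by rewrite face_ideal_colon; apply: face_ideal_eq => T; rewrite linkE.
  apply: (regular_seq_congr (I := face_ideal (skeleton F #|F|))
    (u := elemsym F)) => [||k _|] //.
  - exact/face_ideal_ideal/upS.
  - rewrite -opprB; apply: (ideal_opp (face_ideal_ideal (upS F #|F|))).
    by apply: elemsym_congr => // h _ hF _; rewrite /skeleton hF.
  apply: elemsym_regular_tail (ltnW dF) (elemsym_regular_skeleton (leqnn _)).
  exact/face_ideal_graded/upS.
pose N' T := N T || (F \subset T).
apply: (regular_seq_eqideal (I := face_ideal N')) => [|p|].
- by apply/face_ideal_ideal/upward_adjoin.
- by rewrite face_ideal_adjoin.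
apply: IHc => [||T /orP[/Nd //|sFT]].
- apply: leq_trans le_c; apply: proper_card; apply/properP; split.
    by apply/subsetP => T; rewrite !inE negb_or => /andP[].
  by exists F; rewrite !inE ?NF // /N' subxx orbT.
- exact: upward_adjoin.
by apply: leq_trans dF (subset_leq_card sFT).
Qed.

End SquarefreeMonomialIdeals.

(** * Partitions of a loopless matroid with independent transversals *)

Section Matroid.
Local Open Scope nat_scope.
Variables (T : finType) (base : pred {set T}) (d : nat).
Implicit Types (B S : {set T}) (x y v : T).
Hypothesis card_base : forall B, base B -> #|B| = d.
Hypothesis base_exchange : forall B1 B2 u,
  base B1 -> base B2 -> u \in B1 :\: B2 ->
  exists2 v, v \in B2 :\: B1 & base (v |: (B1 :\ u)).

Definition indep S := [exists B, base B && (S \subset B)].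

Lemma indepP S : reflect (exists2 B, base B & S \subset B) (indep S).
Proof.
by apply: (iffP existsP) => [[B /andP[]]|[B bB sSB]]; exists B; rewrite ?bB.
Qed.

Lemma indepS S S' : S \subset S' -> indep S' -> indep S.
Proof.
by move=> sSS' /indepP[B bB /(subset_trans sSS') sSB]; apply/indepP; exists B.
Qed.

Lemma indep_augment S1 S2 : indep S1 -> indep S2 -> #|S1| < #|S2| ->
  exists2 x, x \in S2 :\: S1 & indep (x |: S1).
Proof.
move=> /indepP[B0 bB0 sS1B0] /indepP[B2 bB2 sS2B2] lt_S12.
pose above B := base B && (S1 \subset B).
have above0 : above B0 by rewrite /above bB0.
(* Among the bases containing S1, one closest to B2 must meet S2 outside S1. *)
have [B /andP[bB sS1B] maxB] := arg_maxnP (fun B => #|B :&: B2|) above0.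
have [S2B|[x]] := set_0Vmem ((S2 :\: S1) :&: B); last first.
  rewrite inE => /andP[xS2 xB]; exists x => //; apply/indepP; exists B => //.
  by rewrite subUset sub1set xB.
have [u] : exists u, u \in (B :\: S1) :\: B2.
  apply/set0Pn; apply: contraTneq lt_S12 => BS1B2; rewrite -leqNgt.
  suff: #|B :\: S1| <= #|B2 :\: S2|.
    have:= subset_leq_card sS2B2; rewrite !cardsD (setIidPr sS1B).
    by rewrite (setIidPr sS2B2) (card_base bB) (card_base bB2); lia.
  apply: subset_leq_card; apply/subsetP => x xBS1.
  have xB2 : x \in B2.
    by apply: contraT => xB2; rewrite -(in_set0 x) -BS1B2 inE xB2.
  rewrite inE xB2 andbT; move: xBS1; rewrite inE => /andP[xS1 xB].
  apply: contraT; rewrite negbK => xS2.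
  by rewrite -(in_set0 x) -S2B !inE xS1 xS2.
rewrite !inE => /and3P[uB2 uS1 uB].
have [|v] := base_exchange bB bB2 (u := u); first by rewrite inE uB2.
rewrite inE => /andP[vB vB2] bB'.
have /maxB : above (v |: (B :\ u)).
  rewrite /above bB' /=; apply: subset_trans (subsetUr _ _).
  by rewrite subsetD1 sS1B.
rewrite /= leqNgt => /negP[]; apply: proper_card; apply/properP; split.
  apply/subsetP => x; rewrite !inE => /andP[xB xB2].
  by rewrite xB xB2 (contraNneq _ uB2) ?orbT // => <-.
by exists v; rewrite !inE ?eqxx ?vB2 // (negbTE vB).
Qed.

Lemma indep_base S : indep S -> #|S| = d -> base S.
Proof.
move=> /indepP[B bB sSB] cS.
have /eqP -> // : S == B.
by rewrite eqEcard sSB cS (card_base bB) /=.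
Qed.

Definition closure S v := (v \in S) || ~~ indep (v |: S).

Lemma closureS S S' v : S \subset S' -> closure S v -> closure S' v.
Proof.
move=> sSS' /orP[vS|nind]; rewrite /closure; first by rewrite (subsetP sSS').
by rewrite (contra (indepS _) nind) ?orbT // setUS.
Qed.

(** The blocks are the differences of consecutive flats in a maximal chain, the
    flats being spanned by the initial segments of a basis.  Each element of a
    transversal lies outside the flat spanned by the earlier ones. *)
Lemma transversal_partition :
    (exists B, base B) -> (forall v, exists2 B, base B & v \in B) ->
  exists p : T -> 'I_d, exists2 b : 'I_d -> T, cancel b p &
    forall u : 'I_d -> T, cancel u p -> base [set u i | i : 'I_d].
Proof.
move=> [B0 bB0] loopless; have cB0 := card_base bB0.
pose b (i : 'I_d) : T := enum_val (cast_ord (esym cB0) i).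
have b_inj : injective b by move=> i j /enum_val_inj /cast_ord_inj.
have bB i : b i \in B0 by apply: enum_valP.
have indB0 : indep B0 by apply/indepP; exists B0.
pose seg (u : 'I_d -> T) k := [set u j | j : 'I_d & j < k].
have segS u k (lt_kd : k < d) : seg u k.+1 = u (Ordinal lt_kd) |: seg u k.
  apply/setP=> x; rewrite inE; apply/imsetP/orP => [[j]|].
    rewrite inE ltnS leq_eqVlt => /predU1P[jk ->|lt_jk ->].
      by left; rewrite inE; apply/eqP; congr u; apply: val_inj.
    by right; apply/imsetP; exists j; rewrite ?inE.
  case=> [/set1P->|/imsetP[j]].
    by exists (Ordinal lt_kd); rewrite // inE.
  by rewrite inE => lt_jk ->; exists j; rewrite // inE ltnS ltnW.
have seg0 u : seg u 0 = set0.
  by apply/setP=> x; rewrite inE; apply/imsetP=> -[j]; rewrite inE.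
have seg_mono u k l : k <= l -> seg u k \subset seg u l.
  move=> le_kl; apply: imsetS; apply/subsetP => j; rewrite !inE => lt_jk.
  exact: leq_trans lt_jk le_kl.
have mem_seg (u : 'I_d -> T) (i : 'I_d) k : i < k -> u i \in seg u k.
  by move=> lt_ik; apply/imsetP; exists i; rewrite ?inE.
have notin_seg (u : 'I_d -> T) (i : 'I_d) : injective u -> u i \notin seg u i.
  move=> u_inj; apply/imsetP=> -[j]; rewrite inE => + /u_inj ij.
  by rewrite ij ltnn.
have card_seg u k : injective u -> k <= d -> #|seg u k| = k.
  move=> u_inj; elim: k => [|k IHk] lt_kd; first by rewrite seg0 cards0.
  rewrite (segS _ _ lt_kd) cardsU1 IHk 1?ltnW //.
  by rewrite (notin_seg _ (Ordinal lt_kd)).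
have ind_seg k : indep (seg b k).
  by apply: indepS indB0; apply/subsetP => _ /imsetP[j _ ->].
have cl_top v : closure (seg b d) v.
  have -> : seg b d = B0.
    apply/eqP; rewrite eqEcard card_seg // cB0 leqnn andbT.
    by apply/subsetP => _ /imsetP[j _ ->].
  rewrite /closure; case: (boolP (v \in B0)) => //= vB0.
  apply/indepP=> -[B /card_base cB /subset_leq_card].
  by rewrite cardsU1 vB0 cB cB0 ltnn.
have cl_bot v : ~~ closure (seg b 0) v.
  rewrite seg0 /closure inE negbK; apply/indepP.
  by have [B bB' vB] := loopless v; exists B; rewrite // setU0 sub1set.
have /fin_all_exists[p pP] v :
    exists k : 'I_d, closure (seg b k.+1) v && ~~ closure (seg b k) v.
  have ex_k : exists k, closure (seg b k) v by exists d.
  have [[|k] cl_k min_k] := ex_minnP ex_k; first by case/negP: (cl_bot v).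
  have lt_kd : k < d by apply: min_k.
  exists (Ordinal lt_kd); rewrite cl_k /=.
  by apply/negP => /min_k; rewrite ltnn.
have p_uniq v (k : 'I_d) :
    closure (seg b k.+1) v -> ~~ closure (seg b k) v -> p v = k.
  move=> cl_k ncl_k; have /andP[cl_p ncl_p] := pP v.
  apply/val_inj/eqP; rewrite eqn_leq /= leqNgt [X in _ && X]leqNgt.
  apply/andP; split; apply/negP => lt.
    by move: ncl_p; rewrite (closureS _ cl_k) // seg_mono.
  by move: ncl_k; rewrite (closureS _ cl_p) // seg_mono.
exists p; exists b => [i|u uK].
  apply: p_uniq; first by rewrite /closure mem_seg.
  rewrite /closure negb_or negbK notin_seg //=.
  by apply: indepS (ind_seg i.+1); rewrite subUset sub1set mem_seg ?seg_mono.
have u_inj : injective u := can_inj uK.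
have ind_u k : k <= d -> indep (seg u k).
  elim: k => [|k IHk] lt_kd; first by rewrite seg0 -(seg0 b).
  have ind_k := IHk (ltnW lt_kd); rewrite (segS _ _ lt_kd).
  set i := Ordinal lt_kd; have /andP[_] := pP (u i); rewrite uK.
  rewrite /closure negb_or negbK => /andP[u_b ind_ub].
  have [|x] := indep_augment ind_k ind_ub.
    by rewrite cardsU1 u_b !card_seg ?(ltnW lt_kd).
  rewrite !inE => /andP[xu /predU1P[-> //|xb]] ind_xu.
  (* Otherwise x is in seg b k, so some earlier u j can be added to seg b k,
     although it belongs to its closure. *)
  have [|y] := indep_augment (ind_seg k) ind_xu.
    by rewrite cardsU1 xu !card_seg ?(ltnW lt_kd).
  rewrite !inE => /andP[yb /predU1P[yx|]]; first by rewrite yx xb in yb.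
  case/imsetP=> j; rewrite inE => lt_jk def_y ind_yb.
  have /andP[cl_y _] := pP y; rewrite def_y uK -def_y in cl_y.
  have:= closureS (seg_mono b _ _ lt_jk) cl_y.
  by rewrite /closure (negbTE yb) ind_yb.
have -> : [set u i | i : 'I_d] = seg u d.
  by apply/setP=> x; apply/imsetP/imsetP=> -[i _ ->]; exists i; rewrite ?inE.
by apply: indep_base; rewrite ?ind_u ?card_seg.
Qed.

End Matroid.

(** * The matching matroid of a graph *)

Section Matchings.
Local Open Scope nat_scope.
Variables (n : nat) (e : rel 'I_n).
Hypotheses (e_sym : ssrbool.symmetric e) (e_irr : irreflexive e).
Implicit Types (M : {set {set 'I_n}}) (E W B : {set 'I_n}) (u v w : 'I_n).

Lemma edgesP E : reflect (exists u w, e u w /\ E = [set u; w]) (E \in edges e).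
Proof.
apply: (iffP imsetP) => [[[u w]]|[u [w [euw ->]]]].
  by rewrite inE /= => euw ->; exists u, w.
by exists (u, w); rewrite ?inE.
Qed.

Lemma edge_neq u w : e u w -> u != w.
Proof. by apply: contraTneq => ->; rewrite e_irr. Qed.

Lemma card_edge E : E \in edges e -> #|E| = 2.
Proof. by case/edgesP=> u [w [/edge_neq uw ->]]; rewrite cards2 uw. Qed.

Lemma edge_other_end E u : E \in edges e -> u \in E ->
  exists w, [/\ e u w, u != w & E = [set u; w]].
Proof.
case/edgesP=> [a [b [eab ->]]]; rewrite !inE => /orP[] /eqP->.
  by exists b; rewrite edge_neq.
by exists a; rewrite e_sym eab eq_sym edge_neq // setUC.
Qed.

Lemma disjoint_pair u w B :
  u \notin B -> w \notin B -> [disjoint [set u; w] & B].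
Proof. by move=> uB wB; rewrite disjoints_subset subUset !sub1set !inE uB. Qed.

Lemma matching0 : is_matching e set0.
Proof.
by rewrite /is_matching sub0set; apply/trivIsetP => ? ?; rewrite inE.
Qed.

Lemma matchingU1 M E : is_matching e M -> E \in edges e ->
    [disjoint E & cover M] ->
  [/\ is_matching e (E |: M), cover (E |: M) = E :|: cover M &
      #|E |: M| = #|M|.+1].
Proof.
move=> /andP[sMe tM] eE dis.
have EM : E \notin M.
  apply: contraTN dis => EM; rewrite -setI_eq0 (setIidPl (bigcup_sup _ EM)) //.
  by rewrite -cards_eq0 card_edge.
split; rewrite ?cardsU1 ?EM //; last by rewrite /cover big_setU1.
by rewrite /is_matching subUset sub1set eE sMe trivIsetU ?trivIset1 ?cover1.
Qed.

Lemma matchingD1 M E : is_matching e M -> E \in M ->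
  [/\ E \in edges e, is_matching e (M :\ E), cover (M :\ E) = cover M :\: E &
      #|M| = #|M :\ E|.+1].
Proof.
move=> /andP[sMe tM] EM; split; first exact: (subsetP sMe).
- by rewrite /is_matching trivIsetD // (subset_trans (subsetDl _ _)).
- exact: coverD1.
by rewrite (cardsD1 E M) EM.
Qed.

Lemma card_cover_matching M : is_matching e M -> #|cover M| = 2 * #|M|.
Proof.
move=> /andP[sMe /eqP <-]; rewrite mulnC -sum_nat_const.
by apply: eq_bigr => E /(subsetP sMe)/card_edge.
Qed.

Lemma edge_not_addable M E :
    is_matching e M -> matching_number e <= #|M| -> E \in edges e ->
  ~~ [disjoint E & cover M].
Proof.
move=> mM maxM eE; apply/negP => /(matchingU1 mM eE)[mEM _ cEM].
have: #|E |: M| <= matching_number e by apply: leq_bigmax_cond.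
by rewrite cEM ltnNge maxM.
Qed.

(** An alternating path argument.  Let uu' be the edge of M1 at u.  As M1 is
    maximum, M2 has an edge u'v.  If M1 misses v, trade uu' for u'v.  Otherwise
    delete u and u' from the graph: there M1 - uu' is still maximum, and what is
    left of the path starts at v. *)
Lemma matching_exchange_in W M1 M2 u :
    is_matching e M1 -> is_matching e M2 -> #|M1| = #|M2| ->
    cover M1 \subset W -> cover M2 \subset W ->
    (forall M, is_matching e M -> cover M \subset W -> #|M| <= #|M1|) ->
    u \in cover M1 -> u \notin cover M2 ->
  exists v M, [/\ v \in cover M2, v \notin cover M1, is_matching e M &
    cover M = v |: (cover M1 :\ u)].
Proof.
have [k] := ubnP #|M1|.
elim: k W M1 M2 u => // k IHk W M1 M2 u; rewrite ltnS => le_k.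
move=> mM1 mM2 cM12 sM1W sM2W maxM uM1 uM2.
have [E1 E1M1 uE1] := bigcupP uM1.
have [eE1 mD1 covD1 cardD1] := matchingD1 mM1 E1M1.
have [u' [euu' uu' def_E1]] := edge_other_end eE1 uE1.
have sE1M1 : E1 \subset cover M1 by apply: (bigcup_sup _ E1M1).
have u'M1 : u' \in cover M1.
  by apply: (subsetP sE1M1); rewrite def_E1 !inE eqxx orbT.
have [u'M2|u'M2] := boolP (u' \in cover M2); last first.
  have [|mM covM cardM] := matchingU1 mM2 eE1.
    by rewrite def_E1 disjoint_pair.
  have /(maxM _ mM) : cover (E1 |: M2) \subset W.
    by rewrite covM subUset sM2W (subset_trans sE1M1).
  by rewrite cardM cM12 ltnn.
have [E2 E2M2 u'E2] := bigcupP u'M2.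
have [eE2 mD2 covD2 cardD2] := matchingD1 mM2 E2M2.
have [v [eu'v u'v def_E2]] := edge_other_end eE2 u'E2.
have vM2 : v \in cover M2.
  by apply/bigcupP; exists E2; rewrite // def_E2 !inE eqxx orbT.
have uv : u != v by apply: contraNneq uM2 => ->.
have [vM1|vM1] := boolP (v \in cover M1); last first.
  have [|mM covM _] := matchingU1 mD1 eE2.
    rewrite covD1 def_E1 def_E2 disjoint_pair // !inE ?eqxx ?orbT //.
    by rewrite (negbTE vM1) andbF.
  exists v, (E2 |: M1 :\ E1); split => //; rewrite covM covD1 def_E1 def_E2.
  apply/setP => x; rewrite !inE.
  case: (eqVneq x u') => [->|_] /=; last by rewrite orbF.
  by rewrite (eq_sym u' u) uu' u'M1 orbT.
have [|||||||w [M [wM2' wM1' mM covM]]] :=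
    IHk (W :\: E1) (M1 :\ E1) (M2 :\ E2) v _ mD1 mD2.
- by rewrite -cardD1.
- by apply: succn_inj; rewrite -cardD1 -cardD2.
- by rewrite covD1 setSD.
- rewrite covD2; apply/subsetP => x; rewrite def_E1 def_E2 !inE.
  case/andP=> /norP[xu' xv] xM2.
  rewrite (subsetP sM2W) // andbT negb_or xu' andbT.
  by apply: contraNneq uM2 => <-.
- move=> M mM; rewrite subsetD => /andP[sMW disM].
  have [|mEM covEM cardEM] := matchingU1 mM eE1; first by rewrite disjoint_sym.
  rewrite -ltnS -cardD1 -cardEM maxM // covEM subUset sMW andbT.
  exact: subset_trans sE1M1 sM1W.
- by rewrite covD1 def_E1 !inE vM1 negb_or (eq_sym v u) uv (eq_sym v u') u'v.
- by rewrite covD2 def_E2 !inE eqxx orbT.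
move: wM2' wM1'; rewrite covD2 covD1 def_E1 def_E2 !inE !negb_or.
case/andP=> /andP[wu' wv] wM2; rewrite wu' andbT => /nandP wM1'.
have wu : w != u by apply: contraNneq uM2 => <-.
have wM1 : w \notin cover M1 by case: wM1' => //; rewrite wu.
have memM x : (x \in cover M) =
    (x == w) || [&& x != v, x != u, x != u' & x \in cover M1].
  by rewrite covM covD1 def_E1 !inE negb_or -!andbA.
have [|mM' covM' _] := matchingU1 mM eE2.
  by rewrite def_E2 disjoint_pair // memM eqxx ?andbF orbF eq_sym.
exists w, (E2 |: M); split=> //; rewrite covM' def_E2; apply/setP => x.
rewrite !inE memM.
case: (eqVneq x u') => [->|xu'] /=.
  by rewrite (eq_sym u' u) uu' u'M1 orbT.
by case: (eqVneq x v) => [->|xv] //=; rewrite (eq_sym v u) uv vM1 orbT.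
Qed.

Definition matchable B := [exists M, [&& is_matching e M,
  #|M| == matching_number e & cover M == B]].

Lemma matchableP B : reflect (exists M, [/\ is_matching e M,
  #|M| = matching_number e & cover M = B]) (matchable B).
Proof.
apply: (iffP existsP) => -[M].
  by case/and3P=> mM /eqP cM /eqP def_B; exists M.
by case=> mM cM def_B; exists M; rewrite mM cM def_B !eqxx.
Qed.

Lemma card_matchable B : matchable B -> #|B| = 2 * matching_number e.
Proof. by case/matchableP=> M [/card_cover_matching + <- <-]. Qed.

Lemma matchable_exchange B1 B2 u :
    matchable B1 -> matchable B2 -> u \in B1 :\: B2 ->
  exists2 v, v \in B2 :\: B1 & matchable (v |: (B1 :\ u)).
Proof.
move=> /matchableP[M1 [mM1 cM1 <-]] /matchableP[M2 [mM2 cM2 <-]].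
rewrite inE => /andP[uM2 uM1].
have [||||v [M [vM2 vM1 mM covM]]] :=
  matching_exchange_in (W := setT) mM1 mM2 _ _ _ _ uM1 uM2.
- by rewrite cM1.
- exact: subsetT.
- exact: subsetT.
- by move=> M mM _; rewrite cM1; apply: leq_bigmax_cond.
exists v; first by rewrite inE vM1.
rewrite -covM; apply/matchableP; exists M; split=> //.
apply/eqP; rewrite -(eqn_pmul2l (isT : 0 < 2)) -card_cover_matching // covM.
rewrite cardsU1 !inE negb_and vM1 orbT -cM1 -card_cover_matching //.
by rewrite (cardsD1 u (cover M1)) uM1.
Qed.

Lemma exists_matchable : exists B, matchable B.
Proof.
have [|M mM maxM] := @eq_bigmax_cond _ (is_matching e) (fun M => #|M|).
  by apply/card_gt0P; exists set0; apply: matching0.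
by exists (cover M); apply/matchableP; exists M.
Qed.

(** A maximum matching missing [v] covers every neighbour w of [v], as the edge
    vw cannot be added; the edge at w can be traded for vw. *)
Lemma mem_matchable v w : e v w -> exists2 B, matchable B & v \in B.
Proof.
move=> evw; have [B /matchableP[M [mM cM covM]]] := exists_matchable.
have [vM|vM] := boolP (v \in cover M).
  by exists (cover M) => //; apply/matchableP; exists M.
have eE : [set v; w] \in edges e by apply/edgesP; exists v, w.
have wM : w \in cover M.
  apply: contraR (edge_not_addable mM _ eE); last by rewrite cM.
  exact: disjoint_pair.
have [E EM wE] := bigcupP wM.
have [_ mD covD cardD] := matchingD1 mM EM.
have [|mM' covM' cardM'] := matchingU1 mD eE.
  by rewrite covD disjoint_pair // !inE ?wE // (negbTE vM) andbF.
exists (cover ([set v; w] |: M :\ E)); last by rewrite covM' !inE eqxx.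
by apply/matchableP; exists ([set v; w] |: M :\ E); rewrite cardM' -cardD.
Qed.

End Matchings.

(** * The highest nonzero squarefree power *)

Section IdealGenerators.

Lemma ideal_gen_ideal (R : comNzRingType) (G : R -> Prop) :
  is_ideal (ideal_gen G).
Proof.
split=> [|a b [s sG ->] [t tG ->]|c a [s sG ->]].
- by exists [::]; rewrite ?big_nil.
- exists (s ++ t); last by rewrite big_cat.
  by move=> q; rewrite mem_cat => /orP[/sG|/tG].
exists [seq (c * q.1, q.2) | q <- s] => [q /mapP[q' /sG Gq' ->] //|].
by rewrite big_map mulr_sumr; apply: eq_bigr => q _ /=; rewrite mulrA.
Qed.

Lemma mem_ideal_gen (R : comNzRingType) (G : R -> Prop) g :
  G g -> ideal_gen G g.
Proof.
move=> Gg; exists [:: (1, g)]; last by rewrite big_seq1 mul1r.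
by move=> q; rewrite inE => /eqP->.
Qed.

Lemma ideal_gen_min (R : comNzRingType) (G I : R -> Prop) : is_ideal I ->
  (forall g, G g -> I g) -> forall g, ideal_gen G g -> I g.
Proof.
move=> idI GI _ [s sG ->]; apply: ideal_sum => // q /sG /GI Iq _.
exact: ideal_mull.
Qed.

Variables (K : fieldType) (n : nat).

Lemma graded_maximal_idealP (f : {mpoly K[n]}) : graded_maximal_ideal f ->
  exists a : 'I_n -> {mpoly K[n]}, f = \sum_j a j * 'X_j.
Proof.
apply: (ideal_gen_min (I := fun g => exists a : 'I_n -> {mpoly K[n]},
  g = \sum_j a j * 'X_j)) => [|_ [i ->]].
  split=> [|f1 f2 [a ->] [b ->]|c f1 [a ->]].
  - by exists (fun=> 0); rewrite big1 // => j _; rewrite mul0r.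
  - exists (fun j => a j + b j); rewrite -big_split.
    by apply: eq_bigr => j _; rewrite mulrDl.
  exists (fun j => c * a j); rewrite mulr_sumr.
  by apply: eq_bigr => j _; rewrite mulrA.
exists (fun j => (j == i)%:R); rewrite (bigD1 i) //= eqxx mul1r.
by rewrite big1 ?addr0 // => j /negbTE->; rewrite mul0r.
Qed.

Lemma elemsym_maximal (F : {set 'I_n}) k :
  (0 < k)%N -> graded_maximal_ideal (elemsym K F k).
Proof.
move=> k_gt0; apply: ideal_sum => [|h _ /andP[_ /eqP ch]].
  exact: ideal_gen_ideal.
have /card_gt0P[i ih] : (0 < #|h|)%N by rewrite ch.
have Uh : (U_(i) <= mesym1 h)%MM by rewrite lep1mP mnmE ih.
rewrite -(submK Uh) mpolyXD; apply: ideal_mull; first exact: ideal_gen_ideal.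
by apply: mem_ideal_gen; exists i.
Qed.

End IdealGenerators.

Section MaximalMatchingPower.
Variables (K : fieldType) (n : nat) (e : rel 'I_n).
Hypotheses (e_sym : ssrbool.symmetric e) (e_irr : irreflexive e).
Implicit Types (T : {set 'I_n}).
Let nu := matching_number e.

Definition contains_matchable T := [exists B, matchable e B && (B \subset T)].

Lemma upward_contains_matchable : upward contains_matchable.
Proof.
move=> T T' sTT' /existsP[B /andP[mB sBT]]; apply/existsP; exists B.
by rewrite mB (subset_trans sBT).
Qed.

Lemma contains_matchable_card T : contains_matchable T -> (2 * nu <= #|T|)%N.
Proof.
by case/existsP=> B /andP[/(card_matchable e_irr) <-]; apply: subset_leq_card.
Qed.

Lemma matching_monomialE M : is_matching e M ->
  matching_monomial K M = 'X_[mesym1 (cover M)].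
Proof.
case/andP=> _ tM; rewrite /matching_monomial -(big_trivIset _ tM) /= mprodXE.
congr 'X_[_]; apply/mnmP => i; rewrite mnmE mnm_sumE big_mkcond /=.
rewrite (bigD1 i) //= mnmE eqxx /= big1 => [|j ne_ji]; first by case: ifP.
by rewrite mnmE (negbTE ne_ji) if_same.
Qed.

Lemma squarefree_powerE (p : {mpoly K[n]}) :
  face_ideal contains_matchable p <-> squarefree_power e nu p.
Proof.
have idF := face_ideal_ideal K upward_contains_matchable.
have idG := ideal_gen_ideal (fun f => exists M : {set {set 'I_n}},
   [/\ is_matching e M, #|M| = nu & f = matching_monomial K M]).
split=> [Fp|]; last first.
  apply: ideal_gen_min idF _ _ => _ [M [mM cM ->]].
  rewrite matching_monomialE //; apply/face_idealX/existsP; exists (cover M).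
  by rewrite subxx andbT; apply/matchableP; exists M.
rewrite [p]mpolyE; apply: (ideal_sum idG) => m /Fp /existsP[B /andP[mB sBm]] _.
case/matchableP: mB => M [mM cM covM].
rewrite -mul_mpolyC; apply: (ideal_mull idG).
have le_Bm : (mesym1 B <= m)%MM by rewrite mesym1_le.
rewrite -(submK le_Bm) mpolyXD; apply: (ideal_mull idG); apply: mem_ideal_gen.
by exists M; split=> //; rewrite matching_monomialE ?covM.
Qed.

Hypothesis no_isolated : forall i : 'I_n, exists j : 'I_n, e i j.

(** The obstruction comes from a partition of the vertices all of whose
    transversals are matchable; Y_i is the restriction to the i-th block of the
    1-form of the variables.  The class survives because I times a variable has
    order larger than 2 nu, the degree of the monomial of a transversal. *)
Lemma regular_seq_squarefree_power s : (0 < nu)%N ->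
    (forall f, f \in s -> graded_maximal_ideal f) ->
  regular_seq (@squarefree_power n e K nu) s -> (size s < 2 * nu)%N.
Proof.
move=> nu_gt0 ms; set d := (2 * nu)%N => reg_s.
rewrite ltnNge; apply/negP => le_ds.
have [p [b bK transv]] := transversal_partition (card_matchable e_irr)
  (@matchable_exchange _ _ e_sym e_irr) (exists_matchable e)
  (fun v => let: ex_intro w evw := no_isolated v in mem_matchable e_irr evw).
pose Y (i : 'I_d) j : {mpoly K[n]} := if p j == i then 'X_j else 0.
have prodX (u : 'I_d -> 'I_n) :
    cancel u p -> \prod_i Y i (u i) = 'X_[(\sum_i U_(u i))%MM].
  move=> uK; rewrite -mprodXE; apply: eq_bigr => i _.
  by rewrite /Y uK eqxx.
have idF := face_ideal_ideal K upward_contains_matchable.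
have [idO _] : graded_ideal (@monomial_ideal K n (fun m => d < mdeg m)%N).
  by apply: monomial_ideal_graded => m m'; rewrite mdegD; lia.
have [] : ~ monomial_ideal (fun m => d < mdeg m)%N (\prod_i Y i (b i)).
  rewrite (prodX b bK) monomial_idealX mdeg_sum.
  rewrite (eq_bigr (fun=> 1%N)) => [|i _]; last exact: mdeg1.
  by rewrite sum_nat_const card_ord muln1 ltnn.
apply: (regular_seq_obstruction (x := fun j => 'X_j) (s := s) idF idO).
- move=> j g Fg; apply/monomial_ideal_colon => m /Fg /contains_matchable_card.
  by move/leq_trans/(_ (card_mvars m)); rewrite mdegD mdeg1.
- by move=> j; rewrite -big_mkcond (big_pred1 (p j)) // => i; rewrite /= eq_sym.
- move=> u; case: (boolP [forall i, p (u i) == i]) => [/forallP uK|].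
    rewrite prodX => [|i]; last exact/eqP.
    apply/monomial_idealX/existsP; exists [set u i | i : 'I_d].
    rewrite transv => [|i]; last exact/eqP.
    apply/subsetP => _ /imsetP[i _ ->].
    by rewrite inE mnm_sumE (bigD1 i) //= mnm1E eqxx.
  case/forallPn=> i ne_i; rewrite (bigD1 i) //= {1}/Y (negbTE ne_i) mul0r.
  exact: ideal0.
- by move=> i k ne_ik; rewrite /Y bK eq_sym (negbTE ne_ik).
- by move=> f /ms /graded_maximal_idealP.
- apply: regular_seq_eqideal reg_s => [|g]; first exact: ideal_gen_ideal.
  by split=> /squarefree_powerE.
- by rewrite card_ord le_ds andbT muln_gt0.
Qed.

Lemma depth_maximal_matching_power : (0 < nu)%N ->
  depth (@graded_maximal_ideal K n) (@squarefree_power n e K nu) = (2 * nu).-1.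
Proof.
move=> nu_gt0; have d_gt0 : (0 < 2 * nu)%N by rewrite muln_gt0.
have depthI : is_depth (@graded_maximal_ideal K n)
    (@squarefree_power n e K nu) (2 * nu).-1.
  split; last first.
    move=> s ms reg_s; rewrite -ltnS (prednK d_gt0).
    exact: regular_seq_squarefree_power reg_s.
  exists (map (elemsym K setT) (countdown (2 * nu).-1)); split.
  - by rewrite size_map size_countdown.
  - move=> f /mapP[k]; rewrite mem_countdown => /andP[k_gt0 _] ->.
    exact: elemsym_maximal.
  apply: regular_seq_eqideal squarefree_powerE _.
    exact/face_ideal_ideal/upward_contains_matchable.
  apply: elemsym_regular => [|T|]; first exact: upward_contains_matchable.
    by rewrite (prednK d_gt0); apply: contains_matchable_card.
  have [B mB] := exists_matchable e.
  rewrite (leq_trans (leq_pred _)) // -(card_matchable e_irr mB).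
  by rewrite -[n in (_ <= n)%N]card_ord max_card.
have [[s [ss ms reg_s]] maxs] :=
  epsilon_spec (inhabits 0%N) _ (ex_intro _ _ depthI).
have [[s' [ss' ms' reg_s']] maxs'] := depthI.
apply/eqP; rewrite eqn_leq; apply/andP; split.
  by rewrite -[depth _ _]ss; apply: maxs'.
by rewrite -[X in (X <= _)%N]ss'; apply: maxs.
Qed.

End MaximalMatchingPower.

Theorem corollary3p5 (K : fieldType) (n : nat) (e : rel 'I_n)
    (n_gt0 : (0 < n)%N)
    (e_sym : ssrbool.symmetric e) (e_irr : irreflexive e)
    (e_no_isolated : forall i : 'I_n, exists j : 'I_n, e i j) :
  normalized_depth e K (matching_number e) = 0.
Proof.
have nu_gt0 : (0 < matching_number e)%N.
  have [B mB iB] : exists2 B, matchable e B & Ordinal n_gt0 \in B.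
    by have [j eij] := e_no_isolated (Ordinal n_gt0); apply: mem_matchable eij.
  have: (0 < #|B|)%N by apply/card_gt0P; exists (Ordinal n_gt0).
  by rewrite (card_matchable e_irr mB) muln_gt0.
rewrite /normalized_depth depth_maximal_matching_power //; lia.
Qed.
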